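(* Let $G$ be a connected simple graph with $\chi(G)=3$ whose vertex set is partitioned into three independent sets $V_1=\{w\}$, $V_2=\{u_1,\ldots,u_x\}$ with $x\ge 2$, and $V_3=\{v_1,\ldots,v_y\}$ with $y\ge 2$, such that $w$ is adjacent to exactly $2a$ vertices of $V_2$ and exactly $2b$ vertices of $V_3$ for some integers $a,b\ge 1$, every vertex of $V_2$ has degree $2m$, and every vertex of $V_3$ has degree $2n$ (for some positive integers $m,n$). Then $\chi_{la}(G)=3$.
   Context: For a graph $G=(V,E)$ with $q$ edges, a bijection $f:E\to\{1,\ldots,q\}$ is a local antimagic labeling if $f^+(u)\ne f^+(v)$ for all adjacent $u,v$, where $f^+(u)$ is the sum of labels of edges incident to $u$. $\chi_{la}(G)$ is the minimum number of distinct values of $f^+$ over all local antimagic labelings of $G$; $\chi(G)$ is the chromatic number. *)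

(* Defs.v *)
From mathcomp Require Import all_boot.

Set Implicit Arguments.
Unset Strict Implicit.
Unset Printing Implicit Defensive.

Record sgraph := SGraph {
  vertex :> finType;
  adj : rel vertex;
  adj_sym : symmetric adj;
  adj_irrefl : irreflexive adj
}.

Section Graph.

Variable G : sgraph.

Definition neighbors (v : G) : {set G} := [set u | adj v u].

Definition degree (v : G) : nat := #|neighbors v|.

Definition connected_graph : Prop := forall u v : G, connect (@adj G) u v.

Definition independent (S : {set G}) : Prop :=
  {in S &, forall u v, ~~ adj u v}.

Definition edges : {set {set G}} :=
  [set [set u; v] | u in [set: G], v in [set: G] & adj u v].

Definition is_minimum (P : nat -> Prop) (k : nat) : Prop :=
  P k /\ forall j, P j -> k <= j.

Definition colorable (k : nat) : Prop :=
  exists c : G -> 'I_k, forall u v : G, adj u v -> c u != c v.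

(* is_chromatic_number k : chi(G) = k *)
Definition is_chromatic_number : nat -> Prop := is_minimum colorable.

(* Labelings are functions on all vertex sets; only their values on the edges
   are ever used. *)
Definition edge_labeling (f : {set G} -> nat) : Prop :=
  {in edges &, injective f} /\
  (forall i, (exists2 e, e \in edges & f e = i) <-> 1 <= i <= #|edges|).

Definition vertex_sum (f : {set G} -> nat) (u : G) : nat :=
  \sum_(e in edges | u \in e) f e.

Definition local_antimagic (f : {set G} -> nat) : Prop :=
  edge_labeling f /\
  forall u v : G, adj u v -> vertex_sum f u != vertex_sum f v.

Definition num_sums (f : {set G} -> nat) : nat :=
  size (undup [seq vertex_sum f u | u : G]).

(* is_la_chromatic_number k : chi_la(G) = k.  A relation rather than a
   function, since a graph without local antimagic labeling (such as K_2) has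
   no such number. *)
Definition is_la_chromatic_number : nat -> Prop :=
  is_minimum (fun k => exists2 f, local_antimagic f & num_sums f = k).

End Graph.

(* Main.v *)
(* Split w into a vertex adjacent to the neighbours of w in V2 and one adjacent
   to those in V3.  The resulting graph is bipartite, with sides V2 + {w} and
   V3 + {w}, all its degrees are even, and it is connected: otherwise G would be
   two bipartite graphs glued at w, hence 2-colourable.  Labelling an Eulerian
   tour that starts at the first copy of w by 1, q, 2, q - 1, ... makes
   consecutive labels add up to q + 1 at V2 and q + 2 at V3, so the sums are
   m (q + 1) on V2, n (q + 2) on V3 and b (q + 1) + a (q + 2) - q/2 at w. *)

Require Import Defs.
From mathcomp Require Import all_boot.
From mathcomp Require Import zify.

Set Implicit Arguments.
Unset Strict Implicit.
Unset Printing Implicit Defensive.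

(** * Pairing the edges at vertices of even degree *)

(** Enumerate each fibre and swap positions 2k and 2k + 1; even size keeps the partner in range.
    Applied to ends of edges, this pairs off the edges at every vertex. *)
Lemma even_fibre_pairing (E : finType) (A : eqType) (al : E -> A) :
  (forall v, ~~ odd #|[pred e | al e == v]|) ->
  exists s : E -> E,
    [/\ involutive s, forall e, s e != e & forall e, al (s e) = al e].
Proof.
move=> evn.
pose L v := enum [pred e | al e == v].
pose flip i := if odd i then i.-1 else i.+1.
pose s e := nth e (L (al e)) (flip (index e (L (al e)))).
have memL e v : (e \in L v) = (al e == v) by rewrite mem_enum.
have idx e : index e (L (al e)) < size (L (al e)) by rewrite index_mem memL.
have fidx e : flip (index e (L (al e))) < size (L (al e)).
  have := idx e; have := evn (al e); rewrite cardE -/(L (al e)) /flip.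
  by case: ifP; lia.
have als e : al (s e) = al e by apply/eqP; rewrite -memL mem_nth.
have ids e : index (s e) (L (al e)) = flip (index e (L (al e))).
  by rewrite index_uniq // enum_uniq.
exists s; split=> // e.
  rewrite {1}/s als ids.
  have -> : flip (flip (index e (L (al e)))) = index e (L (al e)).
    rewrite /flip; move: (index _ _) => i.
    by have [io|io] := boolP (odd i); case: ifP; lia.
  by rewrite (set_nth_default e) ?idx // nth_index // memL.
apply/eqP => /(congr1 (index^~ (L (al e)))); rewrite ids /flip.
by case: ifP; lia.
Qed.

(** * Eulerian closed trails in a connected bipartite multigraph *)

Section ClosedTrails.

Variables (E : finType) (V : eqType) (al be : E -> V).

Implicit Type s t : seq (E * E).

Definition supp s := unzip1 s ++ unzip2 s.

(* A closed trail in the bipartite multigraph with edge set E, where [al e] and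
   [be e] are the ends of e, is cut into pairs of consecutive edges that meet in
   an [al]-end; successive pairs then meet in a [be]-end. *)
Definition trail s :=
  [&& all [pred p | al p.1 == al p.2] s,
      cycle [rel p q | be p.2 == be q.1] s & uniq (supp s)].

Lemma mem_supp s x :
  reflect (exists2 p, p \in s & x = p.1 \/ x = p.2) (x \in supp s).
Proof.
rewrite mem_cat; apply: (iffP orP).
  by case=> /mapP [p ps ->]; exists p => //; [left | right].
by case=> p ps [->|->]; [left | right]; apply: map_f.
Qed.

Lemma supp_perm s t : perm_eq s t -> perm_eq (supp s) (supp t).
Proof. by move=> st; rewrite perm_cat ?perm_map. Qed.

Lemma trail_rot k s : trail s -> trail (rot k s).
Proof.
case/and3P=> als bes us; apply/and3P; split.
- by rewrite (perm_all _ (permEl (perm_rot k s))).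
- by rewrite rot_cycle.
- by rewrite (perm_uniq (supp_perm (permEl (perm_rot k s)))).
Qed.

Lemma trail_rot_to s p :
  trail s -> p \in s ->
  exists s', trail (p :: s') /\ supp (p :: s') =i supp s.
Proof.
move=> ts /rot_to [k s' def]; exists s'; rewrite -def; split.
  exact: trail_rot.
by apply: perm_mem; apply: supp_perm; rewrite perm_rot.
Qed.

Lemma trail_be_head s x :
  trail s -> x \in supp s ->
  exists p s', [/\ trail (p :: s'), be p.1 = be x & supp (p :: s') =i supp s].
Proof.
move=> ts /mem_supp [p ps xp].
have [_ cs _] := and3P ts.
have [q qs bq] : exists2 q, q \in s & be q.1 = be x.
  case: xp => ->; first by exists p.
  (* If x is the second edge of its pair, the cyclically next pair starts at the [be]-end of x. *)
  exists (next s p); first by rewrite mem_next.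
  by have /eqP := next_cycle cs ps.
by have [s' [ts' ss']] := trail_rot_to ts qs; exists q, s'.
Qed.

Lemma trail_al_head s x :
  trail s -> x \in supp s ->
  exists p s', [/\ trail (p :: s'), al p.1 = al x & supp (p :: s') =i supp s].
Proof.
move=> ts /mem_supp [p ps xp].
have [/allP /(_ p ps) /= /eqP alp _ _] := and3P ts.
have [s' [ts' ss']] := trail_rot_to ts ps; exists p, s'; split=> //.
by case: xp => ->.
Qed.

(** At a common [be]-end both trails can be rotated to start there and then concatenated. A common
    [al]-end lies inside a pair, so there the two pairs have to exchange edges. *)
Lemma trail_merge s t x y :
  trail s -> trail t -> ~~ has (mem (supp s)) (supp t) ->
  x \in supp s -> y \in supp t -> (al x == al y) || (be x == be y) ->
  exists2 u, trail u & supp u =i supp s ++ supp t.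
Proof.
move=> ts tt dst xs yt /orP [] /eqP xy.
  have [[p1 p2] [s' [/and3P [/= /andP [/eqP ap as'] cs us] apx ss]]] :=
    trail_al_head ts xs.
  have [[q1 q2] [t' [/and3P [/= /andP [/eqP aq at'] ct ut] aqy st]]] :=
    trail_al_head tt yt.
  (* The new tour runs through p1, q2, along t' back to q1, then through p2 and along s' back to p1;
     all four edges share their [al]-end. *)
  pose u := (p1, q2) :: t' ++ (q1, p2) :: s'.
  have pu : perm_eq (supp u) (supp ((p1, p2) :: s') ++ supp ((q1, q2) :: t')).
    rewrite /u /supp /unzip1 /unzip2 /= !map_cat /=.
    apply/permP => c; rewrite /= !count_cat /= !count_cat /=.
    by move: (c p1 : nat) (c p2 : nat) (c q1 : nat) (c q2 : nat); clear; lia.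
  exists u; last first.
    by move=> z; rewrite (perm_mem pu) mem_cat ss st -mem_cat.
  apply/and3P; split.
  - by rewrite /= all_cat /= as' at' -ap -aq apx aqy xy eqxx.
  - move: cs ct; rewrite /u /= !rcons_path.
    rewrite cat_path last_cat /= => /andP [c1 c2] /andP [c3 c4].
    (* A path depends on its starting pair only through the second edge, so the conditions along s'
       and t' survive the exchange. *)
    have pathE r0 r1 r : r0.2 = r1.2 -> path [rel p q | be p.2 == be q.1] r0 r =
      path [rel p q | be p.2 == be q.1] r1 r by case: r => //= ? ? ->.
    rewrite (pathE _ (q1, q2)) // c3 (pathE _ (p1, p2)) // c1 /=.
    have lastE (r0 r1 : E * E) r : r0.2 = r1.2 -> (last r0 r).2 = (last r1 r).2.
      by case: r.
    by rewrite (lastE _ (q1, q2)) // c4 (lastE _ (p1, p2)).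
  - rewrite (perm_uniq pu) cat_uniq (us : uniq (supp ((p1, p2) :: s'))).
    rewrite (ut : uniq (supp ((q1, q2) :: t'))) andbT.
    by rewrite (eq_has_r st) (eq_has ss).
have [p [s' [/and3P [as' cs us] bpx ss]]] := trail_be_head ts xs.
have [q [t' [/and3P [at' ct ut] bqy st]]] := trail_be_head tt yt.
pose u := (p :: s') ++ (q :: t').
have pu : perm_eq (supp u) (supp (p :: s') ++ supp (q :: t')).
  rewrite /u /supp /unzip1 /unzip2 /= !map_cat /=.
  apply/permP => c; rewrite /= !count_cat /= !count_cat /=.
  move: (c p.1 : nat) (c p.2 : nat) (c q.1 : nat) (c q.2 : nat); clear; lia.
exists u; last first.
  by move=> z; rewrite (perm_mem pu) mem_cat ss st -mem_cat.
apply/and3P; split.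
- by rewrite all_cat as' at'.
- move: cs ct; rewrite /u /= !rcons_path cat_path last_cat /=.
  move=> /andP [-> /eqP c2] /andP [-> /eqP c4].
  by rewrite c2 c4 bpx bqy xy eqxx.
- by rewrite (perm_uniq pu) cat_uniq us ut (eq_has_r st) (eq_has ss) dst.
Qed.

(** Each edge is left at its [al]-end by [sg] and at its [be]-end by [tau], so successive edges fit
    by construction; only that no edge occurs twice needs an argument. *)
Lemma orbit_trail (sg tau : E -> E) e :
  involutive sg -> (forall x, sg x != x) -> (forall x, al (sg x) = al x) ->
  involutive tau -> (forall x, tau x != x) -> (forall x, be (tau x) = be x) ->
  trail [seq (x, sg x) | x <- orbit (tau \o sg) e].
Proof.
move=> sgK sgN als tauK tauN bes; pose rho := tau \o sg.
have rho_inj : injective rho by apply: inj_comp; apply: inv_inj.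
apply/and3P; split.
- by apply/allP => _ /mapP [x _ ->] /=; rewrite als.
- rewrite cycle_map; have := cycle_orbit rho_inj e.
  by apply: sub_cycle => x y /eqP <- /=; rewrite bes.
rewrite /supp /unzip1 /unzip2 -!map_comp /= map_id cat_uniq orbit_uniq /=.
rewrite map_inj_uniq ?orbit_uniq ?andbT; last exact: inv_inj.
apply/hasP => -[_ /mapP [_ /trajectP [i _ ->] ->] /= /trajectP [j _]].
rewrite -/rho.
(* [sg] conjugates [rho] to its inverse, so a collision between the two lists
   would give a fixed point of [sg] or of [tau]. *)
have sgrho k x : iter k rho (sg (iter k rho x)) = sg x.
  by elim: k => [|k IH] //; rewrite iterSr iterS {2}/rho /= sgK tauK.
move=> eij; have : sg e = iter (i + j) rho e by rewrite iterD -eij sgrho.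
(* Halving the exponent: for z the k-th iterate of e, either [sg z = rho z] or [sg z = z], by the
   parity of i + j. The former makes [sg z] a fixed point of [tau]. *)
rewrite -[i + j]odd_double_half -addnn addnA; set k := _./2.
rewrite iterD [_ + k]addnC iterD -(sgrho k).
have rhok_inj : injective (iter k rho) by elim: k => //= k IH x y /rho_inj/IH.
move=> /rhok_inj; case: odd => /eqP.
  by rewrite /rho /= eq_sym (negPf (tauN _)).
by rewrite (negPf (sgN _)).
Qed.


Definition meet : rel E := [rel x y | (al x == al y) || (be x == be y)].

Lemma meet_sym : connect_sym meet.
Proof.
by apply: sym_connect_sym => x y; rewrite /meet /= eq_sym [be x == _]eq_sym.
Qed.

(** Hierholzer's method: start from the orbit trail of e0 and, while an edge is missing, merge in
    the orbit trail of a missing edge that meets the current trail. *)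
Lemma eulerian_trail (e0 : E) :
  (forall v, ~~ odd #|[pred e | al e == v]|) ->
  (forall v, ~~ odd #|[pred e | be e == v]|) ->
  (forall e, connect meet e0 e) ->
  exists2 s, trail s & forall e, e \in supp s.
Proof.
move=> /even_fibre_pairing [sg [sgK sgN als]].
move=> /even_fibre_pairing [tau [tauK tauN bes]] conn.
pose rho := tau \o sg.
pose orb e := [seq (x, sg x) | x <- orbit rho e].
have rho_inj : injective rho by apply: inj_comp; apply: inv_inj.
have orbtr e : trail (orb e) by apply: orbit_trail.
have orbS e x : (x \in supp (orb e)) =
    (x \in orbit rho e) || (sg x \in orbit rho e).
  rewrite /supp /unzip1 /unzip2 -!map_comp /= map_id mem_cat.
  by rewrite -[in x \in map _ _](sgK x) mem_map //; apply: inv_inj.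
have orb_sg e x : x \in supp (orb e) -> sg x \in supp (orb e).
  by rewrite !orbS sgK orbC.
have orb_tau e x : x \in supp (orb e) -> tau x \in supp (orb e).
  have rhoE z : (rho z \in orbit rho e) = (z \in orbit rho e).
    by rewrite -!fconnect_orbit [RHS](same_fconnect1_r rho_inj).
  have e1 : (sg (tau x) \in orbit rho e) = (x \in orbit rho e).
    by rewrite -rhoE /rho /= sgK tauK.
  have e2 : (sg x \in orbit rho e) = (tau x \in orbit rho e).
    by rewrite -rhoE /rho /= sgK.
  by rewrite !orbS e1 e2 orbC.
(* Here n bounds the number of missing edges. Closure of the support under both pairings makes the
   orbit trail of any missing edge disjoint from it. *)
suff /(_ #|E|) main : forall n s,
    trail s -> e0 \in supp s ->
    (forall x, x \in supp s -> sg x \in supp s) ->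
    (forall x, x \in supp s -> tau x \in supp s) ->
    #|E| <= n + size (supp s) ->
    exists2 s, trail s & forall e, e \in supp s.
  apply: (main (orb e0)) => //; last by rewrite leq_addr.
  - by rewrite orbS in_orbit.
  - exact: orb_sg.
  - exact: orb_tau.
elim=> [|n IH] s ts e0s sgs taus les.
  exists s => // e; have [_ _ us] := and3P ts.
  have /subset_cardP/(_ (subset_predT _)) -> // : #|supp s| = #|E|.
  by apply/eqP; rewrite eqn_leq max_card (card_uniqP us).
have [/existsP [e es]|] := boolP [exists e, e \notin supp s]; last first.
  rewrite negb_exists => /forallP h; exists s => // e.
  by rewrite -[_ \in _]negbK.
have [x [y [xs ys xy]]] :
    exists x y, [/\ x \in supp s, y \notin supp s & meet x y].
  have [/existsP [x /existsP [y /and3P [? ? ?]]]|] :=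
    boolP [exists x, exists y, [&& x \in supp s, y \notin supp s & meet x y]].
    by exists x, y.
  rewrite negb_exists => /forallP h.
  have clo : closed meet (mem (supp s)).
    apply: (intro_closed meet_sym) => x y xy xs; have := h x.
    by rewrite negb_exists => /forallP /(_ y); rewrite xs xy andbT negbK.
  by have := closed_connect clo (conn e); rewrite e0s (negPf es).
have dis : ~~ has (mem (supp s)) (supp (orb y)).
  have out i : iter i rho y \notin supp s.
    elim: i => [|i] //=; apply: contra => /taus; rewrite tauK => /sgs.
    by rewrite sgK.
  apply/hasPn => z; rewrite orbS => /orP [] /trajectP [i _] ez.
    by rewrite inE ez out.
  by apply: contra (out i); rewrite -ez; apply: sgs.
have yo : y \in supp (orb y) by rewrite orbS in_orbit.
have [u tu su] := trail_merge ts (orbtr y) dis xs yo xy.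
have memu z : (z \in supp u) = (z \in supp s) || (z \in supp (orb y)).
  by rewrite su mem_cat.
apply: (IH u) => //.
- by rewrite memu e0s.
- by move=> z; rewrite !memu => /orP [/sgs|/orb_sg] ->; rewrite ?orbT.
- by move=> z; rewrite !memu => /orP [/taus|/orb_tau] ->; rewrite ?orbT.
- apply: leq_trans les _; rewrite addSnnS leq_add2l.
  have [_ _ us] := and3P ts; have [_ _ uu] := and3P tu.
  have uy : uniq (y :: supp s) by rewrite /= ys.
  apply: (uniq_leq_size uy) => z; rewrite inE memu.
  by case/orP => [/eqP ->|->] //; rewrite yo orbT.
Qed.

End ClosedTrails.

(** * Labelling the tour and computing the sums at both sides *)

(* The labels along the tour are 1, q, 2, q - 1, ..., so that consecutive labels
   add up to q + 1 and q + 2 in turn, except for q/2 + 2 at the start. *)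
Lemma eulerian_labeling (E : finType) (V : eqType) (al be : E -> V) (e0 : E) :
  (forall v, ~~ odd #|[pred e | al e == v]|) ->
  (forall v, ~~ odd #|[pred e | be e == v]|) ->
  (forall e, connect (meet al be) e0 e) ->
  exists f : E -> nat,
    [/\ injective f,
        forall i, (exists e, f e = i) <-> 1 <= i <= #|E|,
        forall v, 2 * (\sum_(e | al e == v) f e)
          = #|E|.+1 * #|[pred e | al e == v]|
      & forall v, 2 * (\sum_(e | be e == v) f e) + (be e0 == v) * #|E|
          = #|E|.+2 * #|[pred e | be e == v]|].
Proof.
move=> eva evb /(eulerian_trail eva evb) [s0 ts0 cov0].
have [p0 [s' [ts bp0 cov]]] := trail_be_head ts0 (cov0 e0).
have {}cov e : e \in supp (p0 :: s') by rewrite cov.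
set s := p0 :: s' in ts cov; have [als bes us] := and3P ts.
pose x i := (nth p0 s i).1; pose y i := (nth p0 s i).2; pose h := size s.
(* [supp s] lists all first edges, then all second edges, so pair i gets the labels i + 1 and 2h -
   i, where q = 2h. The latter and the first label i + 2 of the next pair add up to q + 2. *)
pose lab := iota 1 h ++ rev (iota h.+1 h).
have szl : size lab = size (supp s).
  by rewrite /lab !size_cat size_rev !size_iota !size_map.
have cardE : #|E| = h + h.
  have <- : #|supp s| = #|E| by apply: eq_card => e; rewrite cov.
  by rewrite (card_uniqP us) size_cat !size_map.
have labP : perm_eq lab (iota 1 #|E|).
  by rewrite cardE iotaD perm_cat2l perm_rev.
have labU : uniq lab by rewrite (perm_uniq labP) iota_uniq.
pose f e := nth 0 lab (index e (supp s)).
have idx e : index e (supp s) < size lab by rewrite szl index_mem.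
have fx i : i < h -> f (x i) = i.+1.
  move=> ih; have -> : x i = nth (x 0) (supp s) i.
    by rewrite nth_cat size_map ih (nth_map p0).
  rewrite /f index_uniq ?size_cat ?size_map ?ltn_addr //.
  by rewrite nth_cat size_iota ih nth_iota.
have fy i : i < h -> f (y i) = h + h - i.
  move=> ih; have -> : y i = nth (x 0) (supp s) (h + i).
    rewrite nth_cat size_map -/h ltnNge leq_addr addKn.
    by rewrite [nth _ (unzip2 _) _](nth_map p0).
  rewrite /f index_uniq ?size_cat ?size_map ?ltn_add2l //.
  rewrite nth_cat size_iota ifN -?leqNgt ?leq_addr // addKn.
  by rewrite nth_rev ?size_iota // nth_iota; move: ih; clear; lia.
have sumE (P : pred E) (F : E -> nat) : \sum_(e | P e) F e =
    \sum_(0 <= i < h) P (x i) * F (x i) + \sum_(0 <= i < h) P (y i) * F (y i).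
  have pe : perm_eq (index_enum E) (supp s).
    apply: uniq_perm => // [|e]; first exact: index_enum_uniq.
    by rewrite mem_index_enum cov.
  rewrite (perm_big _ pe) /= big_cat !big_map !(big_nth p0).
  by congr (_ + _); rewrite big_mkcond; apply: eq_bigr => i _; rewrite mulnbl.
have alE i : i < h -> al (y i) = al (x i).
  by move=> ih; have /eqP := all_nthP p0 als i ih.
have beE i : i < h -> be (y i) = be (x i.+1).
  move=> ih; have /(pathP p0)/(_ i) := bes; rewrite size_rcons => /(_ ih)/eqP.
  by rewrite -rcons_cons !nth_rcons_default.
(* The default [p0] of [nth] closes the cycle: index h, one past the end, reads the first pair
   again. *)
have xh : be (x h) = be (x 0) by rewrite /x nth_default.
have cardS (P : pred E) : #|[pred e | P e]| =
    \sum_(0 <= i < h) P (x i) + \sum_(0 <= i < h) P (y i).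
  rewrite -sum1_card (sumE P (fun=> 1)).
  by congr (_ + _); apply: eq_bigr => i _; rewrite muln1.
exists f; split.
- move=> e e' /eqP; rewrite /f nth_uniq // => /eqP ee.
  by rewrite -(nth_index e (cov e)) ee nth_index.
- move=> i; have -> : (1 <= i <= #|E|) = (i \in lab).
    by rewrite (perm_mem labP) mem_iota add1n ltnS.
  split=> [[e <-]|il]; first by rewrite mem_nth.
  exists (nth e0 (supp s) (index i lab)).
  by rewrite /f index_uniq -?szl ?index_mem // nth_index.
- move=> v; rewrite cardS sumE.
  have -> : \sum_(0 <= i < h) (al (y i) == v)
      = \sum_(0 <= i < h) (al (x i) == v).
    by apply: eq_big_nat => i ih; rewrite alE.
  rewrite addnn -[_.*2]mul2n mulnCA; congr (_ * _).
  rewrite -big_split big_distrr /=.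
  apply: eq_big_nat => i ih; rewrite alE // fx // fy // cardE -mulnDr mulnC.
  by congr (_ * _); move: ih; clear; lia.
- move=> v; rewrite cardS sumE -bp0.
  pose c i : nat := be (x i) == v.
  have c0h : c h = c 0 by rewrite /c xh.
  have -> : \sum_(0 <= i < h) (be (y i) == v) = \sum_(0 <= i < h) c i.+1.
    by apply: eq_big_nat => i ih; rewrite beE.
  have -> : \sum_(0 <= i < h) (be (x i) == v) = \sum_(0 <= i < h) c i.+1.
    have := big_nat_recl h 0 c (leq0n h) (op := addn) (idx := 0).
    rewrite big_nat_recr //= c0h addnC => /eqP; rewrite eqn_add2l => /eqP //.
  have -> : \sum_(0 <= i < h) (be (y i) == v) * f (y i)
      = \sum_(0 <= i < h) c i.+1 * (h + h - i).
    by apply: eq_big_nat => i ih; rewrite beE ?fy.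
  have -> : \sum_(0 <= i < h) (be (x i) == v) * f (x i)
      = \sum_(0 <= i < h) c i * i.+1.
    by apply: eq_big_nat => i ih; rewrite fx.
  rewrite -/(c 0) cardE.
  (* The shifted sum counts the first edge with h + 1 in place of its label 1. The difference h,
     doubled, is the correction q at the starting vertex. *)
  have shift : \sum_(0 <= i < h) c i * i.+1 + c 0 * h
      = \sum_(0 <= i < h) c i.+1 * i.+2.
    have := big_nat_recl h 0 (fun i => c i * i.+1) (leq0n h)
      (op := addn) (idx := 0).
    by rewrite big_nat_recr //= c0h; lia.
  have tot : \sum_(0 <= i < h) c i.+1 * i.+2
      + \sum_(0 <= i < h) c i.+1 * (h + h - i)
      = (h + h).+2 * \sum_(0 <= i < h) c i.+1.
    rewrite -big_split big_distrr; apply: eq_big_nat => i ih /=.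
    by rewrite -mulnDr mulnC; congr (_ * _); move: ih; clear; lia.
  by move: shift tot; clear; nia.
Qed.

(** * Edges of the graph and their ends after splitting w *)

Section Edges.

Variable G : sgraph.

Implicit Types (u v w : G) (e : {set G}) (S T : {set G}).

Lemma edge_adj u v : adj u v -> [set u; v] \in edges G.
Proof. by move=> uv; apply/imset2P; exists u v; rewrite ?inE. Qed.

Lemma edge_at e u :
  e \in edges G -> u \in e -> exists2 v, adj u v & e = [set u; v].
Proof.
case/imset2P=> x y _; rewrite inE /= => /andP [_ xy] ->.
by case/set2P=> ->; [exists y | exists x; rewrite 1?adj_sym 1?setUC].
Qed.

Lemma card_star u S : #|[set [set u; v] | v in S]| = #|S|.
Proof.
apply: card_imset => v v' vv.
have /set2P [vu|//] : v \in [set u; v'] by rewrite -vv set22.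
have /set2P [v'u|//] : v' \in [set u; v] by rewrite vv set22.
by rewrite vu v'u.
Qed.

Lemma edges_at u :
  [set e in edges G | u \in e] = [set [set u; v] | v in neighbors u].
Proof.
apply/setP => e; rewrite inE; apply/andP/imsetP => [[eE ue]|[v]].
  by have [v uv ->] := edge_at eE ue; exists v; rewrite ?inE.
by rewrite inE => uv ->; rewrite edge_adj // set21.
Qed.

(** The vertex sums are a proper colouring; this yields the lower bound by the chromatic number. *)
Lemma colorable_num_sums f : local_antimagic f -> colorable G (@num_sums G f).
Proof.
case=> _ antimagic.
have memS u : vertex_sum f u \in undup [seq vertex_sum f u | u : G].
  by rewrite mem_undup map_f ?mem_enum.
have idx u : index (vertex_sum f u) (undup [seq vertex_sum f u | u : G])
    < num_sums f by rewrite index_mem.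
exists (fun u => Ordinal (idx u)) => u v /antimagic; apply: contraNneq.
case=> /(congr1 (nth 0 (undup [seq vertex_sum f u | u : G]))).
by rewrite !nth_index // => ->.
Qed.

(* Sends an edge that misses S to w; when w is split into a vertex adjacent to
   S and one adjacent to the other class, this is the end in the side of S. *)
Definition end_in w S e : G := odflt w [pick u in e | u \in S].

(** An edge meets an independent set at most once, so [pick] has no choice. *)
Lemma end_in_eq w S e u : independent S -> e \in edges G ->
  u \in e -> u \in S -> end_in w S e = u.
Proof.
move=> indS eE ue uS; rewrite /end_in; case: pickP => [v /andP [ve vS]|/(_ u)].
  have [x ux def] := edge_at eE ue; move: ve; rewrite def /= => /set2P [] // vx.
  by have := indS u v uS vS; rewrite vx ux.
by rewrite ue uS.
Qed.

Lemma end_in_spec w S e :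
  end_in w S e \in e /\ end_in w S e \in S
  \/ end_in w S e = w /\ {in e, forall u, u \notin S}.
Proof.
rewrite /end_in; case: pickP => [v /andP [ve vS]|none]; [by left | right].
by split=> // u ue; apply/negP => uS; have := none u; rewrite ue uS.
Qed.

Lemma end_in_fibre w S u : independent S -> u \in S -> w \notin S ->
  [set e in edges G | end_in w S e == u] = [set e in edges G | u \in e].
Proof.
move=> indS uS wS; apply/setP => e; rewrite !inE.
have [eE|] //= := boolP (e \in edges G); apply/eqP/idP => [eu|ue].
  have := end_in_spec w S e; rewrite eu => -[[]|[uw _]] //.
  by rewrite -uw uS in wS.
exact: end_in_eq.
Qed.

(** An edge that misses S has both ends in T or at w, and since T is independent one of them is
    w. *)
Lemma end_in_fibre_center w S T :
  [set w] :|: S :|: T = [set: G] -> w \notin S -> [disjoint S & T] ->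
  independent S -> independent T ->
  [set e in edges G | end_in w S e == w]
    = [set [set w; v] | v in neighbors w :&: T].
Proof.
move=> cover wS ST indS indT; apply/setP => e; rewrite inE.
apply/andP/imsetP => [[eE /eqP ew]|[v]].
  have out u : u \in e -> u \notin S.
    have := end_in_spec w S e; rewrite ew => -[[_ wS']|[_ /(_ u)]] //.
    by rewrite wS' in wS.
  have mem u : u \in e -> u != w -> u \in T.
    move=> /out uS uw; have : u \in [set: G] by rewrite inE.
    by rewrite -cover !inE (negPf uw) (negPf uS).
  have /imset2P [x y _] := eE; rewrite inE /= => /andP [_ xy] def.
  have we : w \in e.
    have xe : x \in e by rewrite def set21.
    have ye : y \in e by rewrite def set22.
    have [<-//|xw] := x =P w; have [<-//|yw] := y =P w.
    have := indT x y (mem x xe (introN eqP xw)) (mem y ye (introN eqP yw)).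
    by rewrite xy.
  have [v wv defv] := edge_at eE we; exists v => //; rewrite !inE wv /=.
  apply: mem; first by rewrite defv set22.
  by apply: contraTneq wv => ->; rewrite adj_irrefl.
rewrite !inE => /andP [wv vT] ->; split; first exact: edge_adj.
apply/eqP; have [[/set2P [] // -> vS]|[] //] := end_in_spec w S [set w; v].
by have /disjointFr/(_ vS) := ST; rewrite vT.
Qed.

Lemma end_in_other w S u e :
  u != w -> u \notin S -> end_in w S e != u.
Proof.
move=> uw uS; apply/eqP => eu; have := end_in_spec w S e; rewrite eu.
by case=> [[_ uS']|[/eqP]]; [rewrite uS' in uS | rewrite (negPf uw)].
Qed.

End Edges.

(** * Tour labelling for the edge set of a graph *)

(** The edges become a finite type through [enum_val]. Connectivity is stated as an induction
    principle: a predicate that holds at e0 and passes between meeting edges holds at all edges. *)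
Lemma graph_labeling (G : sgraph) (al be : {set G} -> G) (e0 : {set G}) :
  e0 \in edges G ->
  (forall v, ~~ odd #|[set e in edges G | al e == v]|) ->
  (forall v, ~~ odd #|[set e in edges G | be e == v]|) ->
  (forall C : pred {set G}, C e0 ->
     {in edges G &, forall e e', meet al be e e' -> C e -> C e'} ->
     {in edges G, forall e, C e}) ->
  exists f : {set G} -> nat,
    [/\ edge_labeling f,
        forall v, 2 * (\sum_(e in edges G | al e == v) f e)
          = #|edges G|.+1 * #|[set e in edges G | al e == v]|
      & forall v, 2 * (\sum_(e in edges G | be e == v) f e)
            + (be e0 == v) * #|edges G|
          = #|edges G|.+2 * #|[set e in edges G | be e == v]|].
Proof.
move=> e0E eva evb conn.
pose E := 'I_#|edges G|; pose ev (i : E) : {set G} := enum_val i.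
pose rk e : E := enum_rank_in e0E e.
have evK : cancel ev rk by move=> i; apply: enum_valK_in.
have rkK : {in edges G, cancel rk ev} by move=> e eE; apply: enum_rankK_in.
have cardP (P : pred {set G}) :
    #|[pred i | P (ev i)]| = #|[set e in edges G | P e]|.
  transitivity (\sum_(i | P (ev i)) 1); first by rewrite sum1_card.
  by rewrite -(big_enum_val_cond P (fun=> 1)) sum1dep_card.
have conn' (i : E) : connect (meet (al \o ev) (be \o ev)) (rk e0) i.
  rewrite -[i]evK; move: (ev i) (enum_valP i : ev i \in edges G).
  apply: (conn (fun e => connect _ (rk e0) (rk e))); first exact: connect0.
  move=> e e' eE e'E ee' /connect_trans; apply; apply: connect1.
  by rewrite /meet /= !rkK.
have [] := @eulerian_labeling E G (al \o ev) (be \o ev) (rk e0) _ _ conn'.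
- by move=> v; rewrite (cardP (fun e => al e == v)).
- by move=> v; rewrite (cardP (fun e => be e == v)).
move=> f [f_inj f_im f_al f_be]; exists (f \o rk).
have sumP (P : pred {set G}) :
    \sum_(e in edges G | P e) (f \o rk) e = \sum_(i | P (ev i)) f i.
  by rewrite big_enum_val_cond; apply: eq_bigr => i _; rewrite /= evK.
rewrite card_ord in f_im f_al f_be.
split.
- split; first by move=> e e' eE e'E /f_inj/(congr1 ev); rewrite !rkK.
  move=> i; rewrite -f_im; split=> [[e eE <-]|[j <-]]; first by exists (rk e).
  by exists (ev j); rewrite /= ?evK // enum_valP.
- by move=> v; rewrite sumP f_al (cardP (fun e => al e == v)).
- move=> v; rewrite sumP -(cardP (fun e => be e == v)) -f_be /= rkK //.
Qed.

(** * Connectivity of the split graph *)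

Lemma end_in_connected (G : sgraph) (w : G) (S T : {set G}) (C : pred {set G}) :
  connected_graph G -> ~ colorable G 2 ->
  [set w] :|: S :|: T = [set: G] -> w \notin S -> w \notin T ->
  [disjoint S & T] -> independent S -> independent T ->
  {in edges G, forall e, end_in w T e = w -> C e} ->
  {in edges G &, forall e e',
    meet (end_in w S) (end_in w T) e e' -> C e -> C e'} ->
  {in edges G, forall e, C e}.
Proof.
move=> Gconn Gcol cover wS wT ST indS indT CT Cmeet.
have vtx u : [\/ u = w, u \in S | u \in T].
  have : u \in [set: G] by rewrite inE.
  by rewrite -cover !inE -orbA => /or3P [/eqP|uS|uT]; constructor.
have share u e e' : u != w -> e \in edges G -> e' \in edges G ->
    u \in e -> u \in e' -> C e -> C e'.
  move=> uw eE e'E ue ue'; apply: Cmeet => //; rewrite /meet /=.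
  have [/eqP|uS|uT] := vtx u; first by rewrite (negPf uw).
    by rewrite (end_in_eq w indS eE ue uS) (end_in_eq w indS e'E ue' uS) eqxx.
  rewrite orbC (end_in_eq w indT eE ue uT) (end_in_eq w indT e'E ue' uT).
  by rewrite eqxx.
have endS v : adj w v -> v \in T -> end_in w S [set w; v] = w.
  move=> wv vT; apply/eqP; have /setP/(_ [set w; v]) :=
    end_in_fibre_center cover wS ST indS indT.
  by rewrite inE edge_adj //= => ->; apply: imset_f; rewrite !inE wv.
have coverT : [set w] :|: T :|: S = [set: G] by rewrite setUAC.
have endT v : adj w v -> v \in S -> end_in w T [set w; v] = w.
  move=> wv vS; apply/eqP; have /setP/(_ [set w; v]) :=
    end_in_fibre_center coverT wT (etrans (disjoint_sym _ _) ST) indT indS.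
  by rewrite inE edge_adj //= => ->; apply: imset_f; rewrite !inE wv.
(* If C contains one edge from w to T, it contains them all, hence every edge at w. Then C passes
   between any two edges sharing a vertex, and connectivity of G spreads it everywhere. *)
have [/existsP [e1 /and3P [e1E /eqP e1w Ce1]]|none] :=
    boolP [exists e, [&& e \in edges G, end_in w S e == w & C e]].
  have Cw e : e \in edges G -> w \in e -> C e.
    move=> eE we; have [v wv def] := edge_at eE we.
    have [vw|vS|vT] := vtx v; first by rewrite vw adj_irrefl in wv.
      by apply: CT => //; rewrite def endT.
    by apply: (Cmeet e1) => //; rewrite /meet /= e1w def endS ?eqxx.
  pose a := [pred u | [forall e, (e \in edges G) && (u \in e) ==> C e]].
  have clo : closed (@adj G) a.
    apply: intro_closed; first by apply: sym_connect_sym; apply: adj_sym.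
    move=> u v uv /forallP ua; apply/forallP => e.
    apply/implyP => /andP [eE ve].
    have [vw|/eqP vw] := v =P w; first by rewrite vw in ve; apply: Cw.
    apply: (share v [set u; v] e) => //; rewrite ?edge_adj ?set22 //.
    by have := ua [set u; v]; rewrite edge_adj // set21.
  have wa : w \in a.
    by apply/forallP => e; apply/implyP => /andP [eE we]; apply: Cw.
  move=> e eE; have /imset2P [x y _ _ def] := eE.
  have := closed_connect clo (Gconn w x); rewrite wa => /esym/forallP/(_ e).
  by rewrite eE def set21.
(* No edge between w and T is in C, so switching the sides of the edges in C
   turns the sides of the split graph into a 2-colouring of G. *)
case: Gcol; pose inC u := [exists e, [&& e \in edges G, u \in e & C e]].
pose c u := (u != w) && ((u \in S) == inC u).
have inCE e u : e \in edges G -> u \in e -> u != w -> inC u = C e.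
  move=> eE ue uw; apply/existsP/idP => [[e' /and3P [e'E ue' Ce']]|Ce].
    exact: (share u e').
  by exists e; rewrite eE ue.
have notS u : u \in T -> (u \in S) = false by apply: disjointFl.
have notw u (X : {set G}) : u \in X -> w \notin X -> u != w.
  by move=> uX; apply: contraNneq => <-.
(* The edges from w to S are in C and those from w to T are not, so both kinds of neighbours get the
   colour opposite to that of w. *)
have cw v : adj w v -> c v.
  move=> wv; have wvE := edge_adj wv; have ve := set22 w v.
  have [vw|vS|vT] := vtx v; first by rewrite vw adj_irrefl in wv.
    rewrite /c (notw _ _ vS wS) vS (inCE _ _ wvE ve) ?(notw _ _ vS) //.
    by rewrite CT ?endT.
  rewrite /c (notw _ _ vT wT) notS // (inCE _ _ wvE ve) ?(notw _ _ vT) //=.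
  rewrite eq_sym eqbF_neg; apply: contra none => Ce; apply/existsP.
  by exists [set w; v]; rewrite wvE endS ?eqxx.
have cST u v : adj u v -> u \in S -> v \in T -> c u != c v.
  move=> uv uS vT; have uvE := edge_adj uv.
  rewrite /c (notw _ _ uS wS) (notw _ _ vT wT) uS (notS v vT).
  rewrite (inCE _ _ uvE (set21 u v) (notw _ _ uS wS)).
  by rewrite (inCE _ _ uvE (set22 u v) (notw _ _ vT wT)); case: (C _).
have cww : c w = false by rewrite /c eqxx.
exists (fun u => if c u then ord0 else ord_max) => u v uv.
suff : c u != c v by case: (c u); case: (c v).
have vu : adj v u by rewrite adj_sym.
have [uw|uS|uT] := vtx u; have [vw|vS|vT] := vtx v.
- by rewrite uw vw adj_irrefl in uv.
- by rewrite uw cww cw // -uw.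
- by rewrite uw cww cw // -uw.
- by rewrite vw cww cw // -vw.
- by have := indS u v uS vS; rewrite uv.
- exact: cST.
- by rewrite vw cww cw // -vw.
- by rewrite eq_sym cST.
- by have := indT u v uT vT; rewrite uv.
Qed.

(** * Sums of the labelling and their distinctness *)

Theorem theorem2p11 (G : sgraph) (w : G) (V2 V3 : {set G}) (a b m n : nat)
  (Gconn : connected_graph G)
  (Gchi : is_chromatic_number G 3)
  (cover : [set w] :|: V2 :|: V3 = [set: G])
  (w_V2 : w \notin V2) (w_V3 : w \notin V3) (V2_V3 : [disjoint V2 & V3])
  (V2_indep : independent V2) (V3_indep : independent V3)
  (V2_size : 2 <= #|V2|) (V3_size : 2 <= #|V3|)
  (a_ge1 : 1 <= a) (b_ge1 : 1 <= b) (m_ge1 : 1 <= m) (n_ge1 : 1 <= n)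
  (w_adj_V2 : #|neighbors w :&: V2| = 2 * a)
  (w_adj_V3 : #|neighbors w :&: V3| = 2 * b)
  (V2_deg : {in V2, forall u, degree u = 2 * m})
  (V3_deg : {in V3, forall v, degree v = 2 * n}) :
  is_la_chromatic_number G 3.
Proof.
have [_ chi_min] := Gchi.
have V3_V2 : [disjoint V3 & V2] by rewrite disjoint_sym.
have cover' : [set w] :|: V3 :|: V2 = [set: G] by rewrite setUAC.
pose al := end_in w V2; pose be := end_in w V3; pose q := #|edges G|.
have al_w : [set e in edges G | al e == w]
    = [set [set w; v] | v in neighbors w :&: V3].
  exact: end_in_fibre_center.
have be_w : [set e in edges G | be e == w]
    = [set [set w; v] | v in neighbors w :&: V2].
  exact: end_in_fibre_center.
have al_V2 u : u \in V2 ->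
    [set e in edges G | al e == u] = [set e in edges G | u \in e].
  by move=> uV2; apply: end_in_fibre.
have be_V3 u : u \in V3 ->
    [set e in edges G | be e == u] = [set e in edges G | u \in e].
  by move=> uV3; apply: end_in_fibre.
have card_at u : #|[set e in edges G | u \in e]| = degree u.
  by rewrite edges_at card_star.
have card_al_w : #|[set e in edges G | al e == w]| = 2 * b.
  by rewrite al_w card_star.
have card_be_w : #|[set e in edges G | be e == w]| = 2 * a.
  by rewrite be_w card_star.
have vtx u : [\/ u = w, u \in V2 | u \in V3].
  have : u \in [set: G] by rewrite inE.
  by rewrite -cover !inE -orbA => /or3P [/eqP|uS|uT]; constructor.
(* Each edge at w belongs to exactly one copy of w, so the sum at w is the sum over the two
   fibres. *)
have ends e : e \in edges G -> w \in e -> (be e == w) = (al e != w).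
  move=> eE we; have [v wv def] := edge_at eE we.
  have /setP/(_ e) := al_w; rewrite inE eE /= => ->.
  have /setP/(_ e) := be_w; rewrite inE eE /= => ->.
  have mem (X : {set G}) :
      (e \in [set [set w; v] | v in neighbors w :&: X]) = (v \in X).
    rewrite def; apply/imsetP/idP => [[x]|vX].
      rewrite !inE => /andP [wx xX] ee.
      have /set2P [vw|->//] : v \in [set w; x] by rewrite -ee set22.
      by rewrite vw adj_irrefl in wv.
    by exists v; rewrite ?inE ?wv.
  rewrite !mem; have [vw|vV|vV] := vtx v.
  - by rewrite vw adj_irrefl in wv.
  - by rewrite vV (disjointFr V2_V3 vV).
  - by rewrite vV (disjointFl V2_V3 vV).
have w_in X e : e \in [set [set w; v] | v in neighbors w :&: X] -> w \in e.
  by case/imsetP=> v _ ->; rewrite set21.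
have q_ge : 2 * a + 2 * b <= q.
  rewrite -card_be_w -card_al_w -cardsUI.
  rewrite (_ : _ :&: _ = set0) ?cards0 ?addn0; last first.
    apply/setP => e; rewrite !inE.
    apply/negP => /andP [/andP [eE bew] /andP [_ aew]]; move: (bew).
    by rewrite ends ?aew //; apply: (w_in V2); rewrite -be_w inE eE.
  by apply/subset_leq_card/subsetP => e; rewrite !inE -andb_orr => /andP [].
(* The tour starts with an edge from w to V2, whose [be]-end is w, so that the defect q/2 falls on w
   and not on a vertex of V3. *)
have [x] : exists x, x \in neighbors w :&: V2.
  by apply/card_gt0P; rewrite w_adj_V2 muln_gt0.
rewrite !inE => /andP [wx xV2]; pose e0 := [set w; x].
have e0E : e0 \in edges G by apply: edge_adj.
have be_e0 : be e0 = w.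
  apply/eqP; have /setP/(_ e0) := be_w; rewrite inE e0E /= => ->.
  by apply: imset_f; rewrite !inE wx.
have even_al v : ~~ odd #|[set e in edges G | al e == v]|.
  have [->|vV|vV] := vtx v; first by rewrite card_al_w oddM.
    by rewrite al_V2 // card_at V2_deg // oddM.
  rewrite (_ : [set _ in _ | _] = set0) ?cards0 //.
  apply/setP => e; rewrite !inE.
  rewrite (negPf (end_in_other _ _ _)) ?andbF ?(disjointFl V2_V3 vV) //.
  by apply: contraNneq w_V3 => <-.
have even_be v : ~~ odd #|[set e in edges G | be e == v]|.
  have [->|vV|vV] := vtx v; first by rewrite card_be_w oddM.
    rewrite (_ : [set _ in _ | _] = set0) ?cards0 //.
    apply/setP => e; rewrite !inE.
    rewrite (negPf (end_in_other _ _ _)) ?andbF ?(disjointFr V2_V3 vV) //.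
    by apply: contraNneq w_V2 => <-.
  by rewrite be_V3 // card_at V3_deg // oddM.
have [|f [f_lab f_al f_be]] := graph_labeling e0E even_al even_be.
  move=> C Ce0 Cmeet; apply: (end_in_connected Gconn _ cover) => //.
    by move/chi_min.
  move=> e eE ew; apply: (Cmeet e0) => //.
  by apply/orP; right; apply/eqP; apply: etrans be_e0 (esym ew).
have sum_V2 u : u \in V2 -> vertex_sum f u = m * q.+1.
  move=> uV; have := f_al u; rewrite al_V2 // card_at V2_deg //.
  rewrite (_ : \sum_(_ in _ | _) _ = vertex_sum f u); first by rewrite -/q; nia.
  by apply: eq_bigl => e; have /setP/(_ e) := al_V2 u uV; rewrite !inE.
have sum_V3 u : u \in V3 -> vertex_sum f u = n * q.+2.
  move=> uV; have := f_be u; rewrite be_V3 // card_at V3_deg // be_e0.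
  rewrite (negPf (_ : w != u)); last by apply: contraNneq w_V3 => ->.
  rewrite (_ : \sum_(_ in _ | _) _ = vertex_sum f u); first by rewrite -/q; nia.
  by apply: eq_bigl => e; have /setP/(_ e) := be_V3 u uV; rewrite !inE.
have sum_w : 2 * vertex_sum f w + q = q.+1 * (2 * b) + q.+2 * (2 * a).
  have := f_al w; have := f_be w.
  rewrite card_al_w card_be_w be_e0 eqxx mul1n -/q.
  have -> : vertex_sum f w = \sum_(e in edges G | al e == w) f e
      + \sum_(e in edges G | be e == w) f e.
    rewrite /vertex_sum (bigID (fun e => al e == w)) /=.
    congr (_ + _); apply: eq_bigl => e; have [eE|] //= := boolP (e \in edges G).
      by apply: andb_idl => aw; apply: (w_in V3); rewrite -al_w inE eE.
    apply/andP/idP => [[we]|bw]; first by rewrite ends.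
    have we : w \in e by apply: (w_in V2); rewrite -be_w inE eE.
    by rewrite -ends.
  by clear; lia.
have V3_le v : v \in V3 -> 2 * n <= q.
  move=> vV; rewrite -(V3_deg v vV) -card_at.
  by apply/subset_leq_card/subsetP => e; rewrite !inE => /andP [].
(* Equality would give q - 2a = 2(a + b - m)(q + 1), but q - 2a lies strictly between 0 and q +
   1. *)
have w_V2_sum : vertex_sum f w != m * q.+1.
  apply/eqP => sw; move: sum_w; rewrite sw; move: q_ge b_ge1; clear.
  by have [/subnKC <-|/subnKC] := leqP (a + b) m; nia.
(* Equality would give q + 2b = 2(a + b - n)(q + 2), but q + 2b lies strictly between 0 and 2(q +
   2), as 2b is at most q - 2a. *)
have w_V3_sum : vertex_sum f w != n * q.+2.
  apply/eqP => sw; move: sum_w; rewrite sw; move: q_ge a_ge1; clear.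
  by have [/subnKC <-|/subnKC] := leqP (a + b) n; nia.
(* Equality would give (m - n)(q + 1) = n, but 0 < n < q + 1 since 2n is at most q. *)
have V2_V3_sum v : v \in V3 -> m * q.+1 != n * q.+2.
  move/V3_le => n_le; apply/eqP; move: n_ge1 n_le; clear.
  by have [/subnKC <-|/subnKC <-] := leqP m n; nia.
have antimagic : local_antimagic f.
  split=> // u v uv; have [uw|uV|uV] := vtx u; have [vw|vV|vV] := vtx v.
  - by rewrite uw vw adj_irrefl in uv.
  - by rewrite uw (sum_V2 v vV).
  - by rewrite uw (sum_V3 v vV).
  - by rewrite vw eq_sym (sum_V2 u uV).
  - by have := V2_indep u v uV vV; rewrite uv.
  - by rewrite (sum_V2 u uV) (sum_V3 v vV) (V2_V3_sum v).
  - by rewrite vw eq_sym (sum_V3 u uV).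
  - by rewrite (sum_V3 u uV) (sum_V2 v vV) eq_sym (V2_V3_sum u).
  - by have := V3_indep u v uV vV; rewrite uv.
have la_ge g : local_antimagic g -> 3 <= @num_sums G g.
  by move/colorable_num_sums/chi_min.
split; last by move=> k [g /la_ge le_g <-].
exists f => //; apply/eqP; rewrite eqn_leq la_ge // andbT.
apply: (@uniq_leq_size _ _ [:: vertex_sum f w; m * q.+1; n * q.+2]).
  exact: undup_uniq.
move=> s; rewrite mem_undup => /mapP [u _ ->]; rewrite !inE.
by have [->|/sum_V2 ->|/sum_V3 ->] := vtx u; rewrite eqxx ?orbT.
Qed.
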